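(* Let $d\ge 2$, $1\le m\le d-1$, and $\gcd(n,d+1)=1$. The dented pentagram map $T_m$ on twisted $n$-gons in $\mathbb{CP}^d$, with hyperplanes $P_k$ defined by taking the vertices in a row but skipping the $m$th vertex, is invariant with respect to (i.e. commutes with) the scaling transformations $$a_{j,1}\to s^{-1}a_{j,1},\quad a_{j,2}\to s^{-2}a_{j,2},\ \dots,\ a_{j,m}\to s^{-m}a_{j,m},$$ $$a_{j,m+1}\to s^{d-m}a_{j,m+1},\ \dots,\ a_{j,d}\to s\,a_{j,d}$$ (that is, $a_{j,k}\to s^{-k}a_{j,k}$ for $1\le k\le m$ and $a_{j,k}\to s^{d+1-k}a_{j,k}$ for $m+1\le k\le d$) for all $s\in\mathbb C^*$.
   Context: A twisted $n$-gon in $\mathbb{CP}^d$ with monodromy $M\in SL_{d+1}(\mathbb C)$ is a sequence $(v_k)_{k\in\mathbb Z}$ of points of $\mathbb{CP}^d$ with $v_{k+n}=Mv_k$ for all $k$; polygons are generic (no $d+1$ consecutive vertices in one hyperplane) and considered up to projective equivalence. The dented pentagram map, defined generically, is $T_mv_k:=P_k\cap P_{k+1}\cap\dots\cap P_{k+d-1}$, where $P_k$ is the hyperplane through $v_k,\dots,v_{k+m-1},v_{k+m+1},\dots,v_{k+d}$ (skipping $v_{k+m}$). Coordinates: since $\gcd(n,d+1)=1$, the vertices lift to vectors $V_k\in\mathbb C^{d+1}$ with $\det(V_j,\dots,V_{j+d})=1$ and $V_{j+n}=MV_j$ for all $j$; they satisfy $V_{j+d+1}=a_{j,d}V_{j+d}+\dots+a_{j,1}V_{j+1}+(-1)^dV_j$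 with coefficients $n$-periodic in $j$. The $a_{j,k}$, $0\le j\le n-1$, $1\le k\le d$, are coordinates on the space of twisted $n$-gons. *)

(* Defs.v *)
From HB Require Import structures.
From mathcomp Require Import all_boot all_order all_algebra.
From mathcomp Require Import boolp reals complex.

Set Implicit Arguments.
Unset Strict Implicit.
Unset Printing Implicit Defensive.

Import Order.TTheory GRing.Theory Num.Theory.
Local Open Scope ring_scope.

Section DentedPentagram.
Variables (K : fieldType) (d : nat).

(* Points of the projective space P^d(K) are the lines of K^(d+1), and its    *)
(* hyperplanes are the d-dimensional subspaces of K^(d+1).                     *)
Local Notation E := 'cV[K]_d.+1.

Definition proj_point (U : {vspace E}) : Prop := \dim U = 1%N.
Definition hyperplane (H : {vspace E}) : Prop := \dim H = d.

Definition generic_polygon (v : int -> {vspace E}) : Prop :=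
  forall (k : int) (H : {vspace E}), hyperplane H ->
    ~ (forall i : 'I_d.+1, (v (k + i%:Z)%R <= H)%VS).

Definition twisted_ngon (n : nat) (M : 'M[K]_d.+1) (v : int -> {vspace E}) :
    Prop :=
  [/\ \det M = 1,
      forall k, proj_point (v k),
      forall k, v (k + n%:Z) = (linfun (mulmx M) @: v k)%VS
    & generic_polygon v].

(* For a generic polygon the span below is a hyperplane. *)
Definition dented_hyperplane (m : nat) (v : int -> {vspace E}) (k : int) :
    {vspace E} :=
  (\sum_(i < d.+1 | (i : nat) != m) v (k + i%:Z)%R)%VS.

(* The intersection may have dimension > 1: the dented pentagram map is        *)
(* defined at v only if [dented v] is again a generic polygon.                 *)
Definition dented (m : nat) (v : int -> {vspace E}) (k : int) : {vspace E} :=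
  (\bigcap_(i < d) dented_hyperplane m v (k + i%:Z)%R)%VS.

Definition frame (V : int -> E) (j : int) : 'M[K]_d.+1 :=
  \matrix_(r, c) V (j + (c : nat)%:Z) r 0.

(* [A j k] is the coefficient a_{j,k+1}.  Every integer is uniquely of the     *)
(* form j + q n with 0 <= j < n, so the recurrence below is imposed at all     *)
(* integers, with n-periodic coefficients.                                     *)
Definition ngon_coords (n : nat) (M : 'M[K]_d.+1) (v : int -> {vspace E})
    (A : 'M[K]_(n, d)) : Prop :=
  exists V : int -> E,
    [/\ forall j, v j = <[V j]>%VS,
        forall j, \det (frame V j) = 1,
        forall j, V (j + n%:Z) = M *m V j
      & forall (j : 'I_n) (q : int), let j' := (j : nat)%:Z + q * n%:Z in
          V (j' + d.+1%:Z) =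
            \sum_(k < d) A j k *: V (j' + k.+1%:Z) + (-1) ^+ d *: V j'].

(* The graph of T_m in coordinates.  T_m v keeps the monodromy M in SL_{d+1}   *)
(* of v (M itself, not only its class up to (d+1)-st roots of unity), and its  *)
(* coordinates are taken with respect to that M.  When n and d+1 are coprime,  *)
(* A determines (v, M) up to projective equivalence and (T_m v, M) determines  *)
(* B, so this is the graph of a partial function.                              *)
Definition dented_graph (n m : nat) (A B : 'M[K]_(n, d)) : Prop :=
  exists (M : 'M[K]_d.+1) (v : int -> {vspace E}),
    [/\ twisted_ngon n M v, ngon_coords M v A,
        twisted_ngon n M (dented m v) & ngon_coords M (dented m v) B].

Definition dented_coords (n m : nat) (A : 'M[K]_(n, d)) :
    option 'M[K]_(n, d) :=
  if pselect (exists B, dented_graph m A B) is left AB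
  then Some (projT1 (cid AB)) else None.

Definition scaling (n m : nat) (s : K) (A : 'M[K]_(n, d)) : 'M[K]_(n, d) :=
  \matrix_(j, k)
    ((if (k.+1 <= m)%N then s ^- k.+1 else s ^+ (d.+1 - k.+1)) * A j k).

End DentedPentagram.

(* Main.v *)
Require Import Defs.
From mathcomp Require Import all_boot all_order all_algebra.
From mathcomp Require Import boolp reals complex.
From mathcomp Require Import zify ring.
Import Order.TTheory GRing.Theory Num.Theory.
Local Open Scope ring_scope.
Local Open Scope complex_scope.

Set Implicit Arguments.
Unset Strict Implicit.
Unset Printing Implicit Defensive.

(** The scaling symmetry is visible on the inverse of the dented pentagram map,
    which is much simpler than the map itself.

    Write d = m + h and put the recurrence of a polygon W in the form
    \sum_(0 <= k <= d+1) b_(j,k) W_(j+k) = 0, with b_(j,0) = (-1)^d and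
    b_(j,d+1) = -1.  Cut it as low + high = 0, where low is the part k <= m and
    high the part k > m.  If W is the image of V under the dented map, then d
    consecutive vertices of W span each hyperplane P_k of V, and V_(j+m+d) lies
    on all the hyperplanes P_i, j+m <= i <= j+m+d, but P_(j+d).  The h
    hyperplanes before the gap meet in the span of W_j, ..., W_(j+m), and the m
    hyperplanes after it meet in the span of W_(j+m+1), ..., W_(j+d+1).  Hence
    V_(j+m+d) = c_j (low b W)_j = - c_j (high b W)_j for some scalar c_j
    ([dented_inverse]); conversely such a formula recovers W from V
    ([dented_of_inverse]).

    Let V satisfy the recurrence with coefficients a.  Replacing each V in
    low a V by the high part of W and each V in high a V by the low part of W
    leaves a relation between the d+1 independent vectors W_(j+m+1), ...,
    W_(j+m+d+1), so its coefficients vanish ([refactor_coef_eq0]): this is the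
    refactorization of difference operators behind the map.  Every term of the
    coefficient of W_(j+m+1+p) is a product of a low and a high coefficient with
    total shift p, so under the scaling it is multiplied by s^(h-p), whatever
    the term ([refactor_coef_scale]).  The refactorization equations thus hold
    for the scaled coefficients with the same scalars c.

    It remains to build the scaled polygons: W' by solving the scaled recurrence
    and V' by the formula above, so that V' satisfies the scaled recurrence.  A
    linear form vanishing on all of V' gives a scalar sequence killed by both
    the low and the high part of the scaled operator; up to the gauge factor s^j
    it is killed by the unscaled ones, hence is a linear form on W vanishing on
    V, hence zero ([inverse_dented_scale_generic]).  A constant factor,
    which is a (d+1)-st root, normalizes the determinants of V'.

    Finally [dented_graph_functional] shows that coordinates of the image depend
    only on the coordinates of the polygon.  This is where n and d+1 have to be
    coprime: the ratio of two lifts is both n- and (d+1)-periodic. *)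

(** * Linear recurrences and frames *)

Section LinearRecurrences.
Variables (K : fieldType) (d : nat).
Implicit Types (b : int -> nat -> K) (V W : int -> 'cV[K]_d.+1).

Definition satisfies p b (X : int -> 'cV[K]_p) : Prop :=
  forall j, \sum_(k < d.+2) b j k *: X (j + k%:Z) = 0.

(** With the last coefficient -1 the recurrence is homogeneous and both of its
    ends are invertible; the first one makes the determinants of the frames
    constant. *)
Definition polygon_coefs b : Prop :=
  forall j, b j 0%N = (-1) ^+ d /\ b j d.+1 = -1.

Lemma satisfies_mul p q (g : 'M[K]_(q, p)) b (X : int -> 'cV[K]_p) :
  satisfies b X -> satisfies b (fun j => g *m X j).
Proof.
move=> bX j; rewrite -[RHS](mulmx0 _ g) -(bX j) mulmx_sumr.
by apply: eq_bigr => k _; rewrite scalemxAr.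
Qed.

Lemma satisfies_shift p b (X : int -> 'cV[K]_p) n :
  (forall j k, b (j + n) k = b j k) ->
  satisfies b X -> satisfies b (fun j => X (j + n)).
Proof.
move=> bn bX j; rewrite -[RHS](bX (j + n)).
by apply: eq_bigr => k _; rewrite bn addrAC.
Qed.

(** Both extreme coefficients are units, so the recurrence propagates zeros in
    both directions. *)
Lemma satisfies_eq0 p b (X : int -> 'cV[K]_p) j0 :
  polygon_coefs b -> satisfies b X ->
  (forall i, (i < d.+1)%N -> X (j0 + i%:Z) = 0) -> forall j, X j = 0.
Proof.
move=> hb bX X0.
have up n i : (i < d.+1)%N -> X (j0 + n%:Z + i%:Z) = 0.
  elim: n i => [|n IH] i lti; first by rewrite addr0 X0.
  have [lt_id|ge_id] := ltnP i d.
    by rewrite -(IH i.+1)//; congr X; lia.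
  have := bX (j0 + n%:Z); rewrite big_ord_recr /= big1 => [|k _]; last first.
    by rewrite IH ?scaler0.
  rewrite add0r (hb _).2 scaleN1r => /eqP; rewrite oppr_eq0 => /eqP <-.
  by congr X; lia.
have down n i : (i < d.+1)%N -> X (j0 - n%:Z + i%:Z) = 0.
  elim: n i => [|n IH] i lti; first by rewrite subr0 X0.
  case: i lti => [|i] lti; last by rewrite -(IH i (ltnW lti)); congr X; lia.
  have := bX (j0 - n.+1%:Z); rewrite big_ord_recl /= big1 => [|k _]; last first.
    rewrite (_ : X _ = 0) ?scaler0// -(IH k)//; congr X.
    by rewrite /bump /=; lia.
  by rewrite addr0 (hb _).1 => /eqP; rewrite scaler_eq0 signr_eq0 => /eqP.
move=> j; have [le0j|ltj0] := leP j0 j.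
  by rewrite -(up `|(j - j0)%R|%N 0%N isT); congr X; lia.
by rewrite -(down `|(j - j0)%R|%N 0%N isT); congr X; lia.
Qed.

Lemma frame_mul V j (y : 'cV[K]_d.+1) :
  frame V j *m y = \sum_(i < d.+1) y i 0 *: V (j + i%:Z).
Proof.
apply/colP => r; rewrite !mxE summxE; apply: eq_bigr => i _.
by rewrite !mxE mulrC.
Qed.

Lemma mul_frame p (g : 'M[K]_(p, d.+1)) V j i :
  (i < d.+1)%N -> g *m V (j + i%:Z) = col (inord i) (g *m frame V j).
Proof.
move=> lti; apply/colP => r; rewrite !mxE; apply: eq_bigr => k _.
by rewrite !mxE inordK.
Qed.

Lemma frame_mulmx (g : 'M[K]_d.+1) V j :
  frame (fun k => g *m V k) j = g *m frame V j.
Proof.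
apply/matrixP => r c; rewrite !mxE.
by apply: eq_bigr => k _; rewrite !mxE.
Qed.

Lemma frame_free V j (y : nat -> K) :
    \det (frame V j) != 0 -> \sum_(i < d.+1) y i *: V (j + i%:Z) = 0 ->
  forall i, (i < d.+1)%N -> y i = 0.
Proof.
move=> Vj y0 i lti; have uV : frame V j \in unitmx by rewrite unitmxE unitfE.
have: frame V j *m (\col_(i < d.+1) y i) = 0.
  by rewrite frame_mul -[RHS]y0; apply: eq_bigr => k _; rewrite mxE.
move/(congr1 (mulmx (invmx (frame V j)))); rewrite mulKmx// mulmx0.
by move/colP/(_ (Ordinal lti)); rewrite !mxE.
Qed.

Lemma frame_span V j (x : 'cV[K]_d.+1) : \det (frame V j) != 0 ->
  exists y : nat -> K, x = \sum_(i < d.+1) y i *: V (j + i%:Z).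
Proof.
move=> Vj; have uV : frame V j \in unitmx by rewrite unitmxE unitfE.
exists (fun i => (invmx (frame V j) *m x) (inord i) 0).
rewrite -[LHS](mulKVmx uV) frame_mul.
by apply: eq_bigr => i _; rewrite inord_val.
Qed.

Lemma frame_neq0 V j : \det (frame V j) != 0 -> V j != 0.
Proof.
apply: contraNneq => V0; rewrite (expand_det_col _ ord0) big1// => i _.
by rewrite mxE addr0 V0 mxE mul0r.
Qed.

Lemma frame_eq0 p (g : 'M[K]_(p, d.+1)) V j : \det (frame V j) != 0 ->
  (forall i, (i < d.+1)%N -> g *m V (j + i%:Z) = 0) -> g = 0.
Proof.
move=> Vj gV; have uV : frame V j \in unitmx by rewrite unitmxE unitfE.
rewrite -[g](mulmxK uV) (_ : g *m _ = 0) ?mul0mx//.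
apply/matrixP => r c; have /colP/(_ r) := gV c (ltn_ord c).
rewrite mul_frame// inord_val => gc.
by move: gc; rewrite mxE => ->; rewrite !mxE.
Qed.

(** The vertices of a nondegenerate solution are a universal solution: every
    other one is its image under a constant matrix. *)
Lemma satisfies_unique p b V (X : int -> 'cV[K]_p) :
    polygon_coefs b -> satisfies b V -> satisfies b X ->
    \det (frame V 0) != 0 ->
  exists g : 'M[K]_(p, d.+1), forall j, X j = g *m V j.
Proof.
move=> hb bV bX V0; have uV : frame V 0 \in unitmx by rewrite unitmxE unitfE.
pose F := \matrix_(r < p, c < d.+1) X (c : nat)%:Z r 0.
exists (F *m invmx (frame V 0)) => j; apply/eqP; rewrite -subr_eq0; apply/eqP.
move: j; apply: (@satisfies_eq0 _ b _ 0 hb).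
  (* The difference of two solutions is a solution. *)
  move=> j; under eq_bigr do rewrite scalerBr.
  by rewrite sumrB bX sub0r (satisfies_mul _ bV j) oppr0.
move=> i lti; rewrite mul_frame// mulmxKV//.
apply/eqP; rewrite subr_eq0; apply/eqP/colP => r.
by rewrite !mxE inordK// add0r.
Qed.

(** The transition matrix from one frame to the next. *)
Definition companion b j : 'M[K]_d.+1 :=
  \matrix_(r, c) if (c < d)%N then ((r : nat) == c.+1)%:R else b j r.

Lemma det_companion b j : polygon_coefs b -> \det (companion b j) = 1.
Proof.
move=> hb; rewrite (expand_det_row _ ord0) big_ord_recr /= big1 ?add0r => [|i _].
  rewrite mxE ltnn /cofactor (_ : row' _ _ = 1%:M) ?det1.
    by rewrite (hb j).1 mulr1 add0n -expr2 sqrr_sign.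
  apply/matrixP => r c; rewrite !mxE lift0 lift_max ltn_ord.
  by rewrite eqSS.
by rewrite mxE /= ltn_ord mul0r.
Qed.

Lemma frame_companion b V j : polygon_coefs b -> satisfies b V ->
  frame V (j + 1) = frame V j *m companion b j.
Proof.
move=> hb bV; apply/matrixP => r c.
rewrite !mxE; have [ltcd|gecd] := ltnP c d.
  have ltc : (c.+1 < d.+1)%N by [].
  rewrite (bigD1 (Ordinal ltc))//= big1 ?addr0 => [|i ne_i].
    rewrite !mxE ltcd eqxx mulr1; congr (V _ _ _) => /=; lia.
  by rewrite !mxE ltcd -(inj_eq val_inj) /= in ne_i *; rewrite (negPf ne_i) mulr0.
have -> : V (j + 1 + c%:Z) = V (j + d.+1%:Z) by congr V; have := ltn_ord c; lia.
have := bV j; rewrite big_ord_recr /= (hb j).2 scaleN1r.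
move/eqP; rewrite subr_eq0 => /eqP <-; rewrite summxE.
by apply: eq_bigr => i _; rewrite !mxE ltnNge gecd mulrC.
Qed.

Lemma det_frame_const b V : polygon_coefs b -> satisfies b V ->
  forall j, \det (frame V j) = \det (frame V 0).
Proof.
move=> hb bV; have step j : \det (frame V (j + 1)) = \det (frame V j).
  by rewrite (frame_companion _ hb bV) det_mulmx det_companion// mulr1.
elim/int_rect => // n IH; rewrite -IH.
  by rewrite -[RHS]step; congr (\det (frame V _)); lia.
by rewrite -[LHS]step; congr (\det (frame V _)); lia.
Qed.

(** Products of companion matrices and of their inverses give the frames. *)
Lemma satisfies_exists b : polygon_coefs b ->
  exists2 V : int -> 'cV[K]_d.+1, satisfies b V & forall j, \det (frame V j) = 1.
Proof.
move=> hb; pose C := companion b.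
have uC j : C j \in unitmx by rewrite unitmxE det_companion// unitr1.
pose up := fix up n := if n is n'.+1 then up n' *m C n'%:Z else 1%:M.
pose dn := fix dn n :=
  if n is n'.+1 then dn n' *m invmx (C (- n'.+1%:Z)) else 1%:M : 'M_d.+1.
pose F j := match j with Posz n => up n | Negz n => dn n.+1 end.
have FS j : F (j + 1) = F j *m C j.
  case: j => [n|n]; first by rewrite -PoszD addn1.
  rewrite NegzE /=; rewrite mulmxKV//.
  by case: n => [|n] //; rewrite (_ : _ + 1 = Negz n)//; lia.
pose V j := col 0 (F j).
(* Shifting the index by one shifts the columns of F to the left. *)
have colF j c : (c < d.+1)%N -> col (inord c) (F j) = V (j + c%:Z).
  elim: c j => [|c IH] j ltc.
    by rewrite addr0 -[inord 0]/(inord (@ord0 d)) inord_val.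
  rewrite (_ : j + _ = j + 1 + c%:Z); last lia.
  rewrite -IH; last exact: ltnW.
  apply/colP => r; rewrite FS !mxE (bigD1 (inord c.+1))//= big1 ?addr0 => [|i ne_i].
    by rewrite !mxE !inordK// ?(ltnW ltc)// -ltnS ltc eqxx mulr1.
  rewrite !mxE inordK ?(ltnW ltc)// -ltnS ltc.
  rewrite -(inj_eq val_inj) /= inordK// in ne_i.
  by rewrite (negPf ne_i) mulr0.
have frF j : frame V j = F j.
  apply/matrixP => r c; rewrite mxE -colF// inord_val mxE //.
exists V => [j|].
  rewrite big_ord_recr /= (hb j).2 scaleN1r; apply/eqP; rewrite subr_eq0; apply/eqP.
  rewrite (_ : j + _ = j + 1 + d%:Z); last lia.
  rewrite -colF// FS -frF; apply/colP => r; rewrite summxE !mxE.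
  by apply: eq_bigr => i _; rewrite !mxE inordK// ltnn mulrC.
suff detF j : \det (F j) = 1 by move=> j; rewrite frF.
have step j' : \det (F (j' + 1)) = \det (F j').
  by rewrite FS det_mulmx det_companion// mulr1.
elim/int_rect: j => [|n IH|n IH]; first by rewrite det1.
  by rewrite -IH -[RHS]step; congr (\det (F _)); lia.
by rewrite -IH -[LHS]step; congr (\det (F _)); lia.
Qed.

End LinearRecurrences.

(** * Hyperplanes of the dented map *)

Section DentedHyperplanes.
Variables (K : fieldType) (d : nat).
Implicit Types (V W : int -> 'cV[K]_d.+1) (v : int -> {vspace 'cV[K]_d.+1}).

(** Genericity, expressed on a lift of the polygon. *)
Definition generic_lift V : Prop := forall j, \det (frame V j) != 0.

(** The d+2 vectors W_j, ..., W_(j+d+1) have rank d+1, so the recurrence is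
    their only relation up to a factor. *)
Lemma relation_unique b W j (f : nat -> K) : generic_lift W ->
    polygon_coefs d b -> satisfies d b W ->
    \sum_(k < d.+2) f k *: W (j + k%:Z) = 0 ->
  forall k, (k <= d.+1)%N -> f k = - f d.+1 * b j k.
Proof.
move=> Wj hb bW fW k; rewrite leq_eqVlt => /orP[/eqP->|ltk].
  by rewrite (hb j).2 mulrN1 opprK.
apply/eqP; rewrite mulNr -subr_eq0 opprK; apply/eqP.
apply: (@frame_free _ _ W j (fun k => f k + f d.+1 * b j k)) ltk => //.
transitivity (\sum_(k < d.+2) (f k + f d.+1 * b j k) *: W (j + k%:Z)).
  by rewrite [RHS]big_ord_recr /= (hb j).2 mulrN1 subrr scale0r addr0.
under eq_bigr do rewrite scalerDl -scalerA.
by rewrite big_split /= fW add0r -scaler_sumr bW scaler0.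
Qed.


Lemma generic_lift_polygon V v : generic_lift V ->
  (forall j, v j = <[V j]>%VS) -> generic_polygon v.
Proof.
move=> Vk vV k H dimH vH.
suff: (fullv <= H)%VS.
  move/dimvS; rewrite dimvf [\dim H]dimH /dim /= muln1; lia.
apply/subvP => x _; have [y ->] := frame_span x (Vk k).
apply: memv_suml => i _; rewrite memvZ//; apply: (subvP (vH i)).
by rewrite vV memv_line.
Qed.

(** When phi_k is an equation of the hyperplane through W_(k-d+1), ..., W_k, the
    common zeros of r consecutive such forms are spanned by the d+1-r vertices
    common to these hyperplanes.  Each form removes the last vertex that is
    left, because it kills the other remaining ones but not that one. *)
Lemma span_of_annihilated W (phi : int -> 'rV[K]_d.+1) a r x :
    generic_lift W ->
    (forall k l, (l < d)%N -> phi k *m W (k - l%:Z) = 0) ->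
    (forall k, phi k *m W (k + 1) != 0) -> (r <= d)%N ->
    (forall i, (i < r)%N -> phi (a + d%:Z - 1 - i%:Z) *m x = 0) ->
  exists y : nat -> K, x = \sum_(l < d.+1 - r) y l *: W (a + l%:Z).
Proof.
move=> Wk phi0 phi1; elim: r => [_ _|r IH ltrd phix].
  by rewrite subn0; apply: frame_span.
have [|i lti|y def_x] := IH; first exact: ltnW.
  by rewrite phix// ltnW.
rewrite subSS; move: def_x; rewrite subSn; last exact: ltnW.
rewrite big_ord_recr /=; set t := y (d - r)%N => def_x.
suff t0 : t = 0 by exists y; rewrite def_x t0 scale0r addr0.
have := phix r (leqnn _); rewrite def_x mulmxDr mulmx_sumr big1 ?add0r => [|l _].
  rewrite -scalemxAr => /eqP; rewrite scaler_eq0 => /orP[/eqP//|].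
  move: (phi1 (a + d%:Z - 1 - r%:Z)).
  by rewrite (_ : _ + 1 = a + (d - r)%N%:Z) => [/negPf->//|]; lia.
rewrite -scalemxAr (_ : a + l%:Z = a + d%:Z - 1 - r%:Z - (d - 1 - r - l)%N%:Z).
  by rewrite phi0 ?scaler0//; lia.
by have := ltn_ord l; lia.
Qed.

Variable m : nat.
Hypothesis lemd : (m <= d)%N.

(** The equation of the k-th dented hyperplane, normalized at the vertex that is
    skipped: a vector of the basis dual to the k-th frame. *)
Definition hyperplane_form V k : 'rV[K]_d.+1 :=
  row (inord m) (invmx (frame V k)).

Lemma hyperplane_form_vertex V k i : generic_lift V -> (i < d.+1)%N ->
  hyperplane_form V k *m V (k + i%:Z) = (i == m)%:R%:M.
Proof.
move=> Vk lti; have uV : frame V k \in unitmx by rewrite unitmxE unitfE.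
rewrite mul_frame// /hyperplane_form -row_mul mulVmx//.
apply/colP => r; rewrite !mxE !ord1 eqxx mulr1n -(inj_eq val_inj) /= !inordK//.
by rewrite eq_sym.
Qed.

Lemma hyperplane_form_skipped V k : generic_lift V ->
  hyperplane_form V k *m V (k + m%:Z) = 1%:M.
Proof. by move=> Vk; rewrite hyperplane_form_vertex// eqxx. Qed.

Lemma hyperplane_form_kept V k i : generic_lift V -> (i < d.+1)%N -> i != m ->
  hyperplane_form V k *m V (k + i%:Z) = 0.
Proof.
by move=> Vk lti /negPf im; rewrite hyperplane_form_vertex// im mulr0n raddf0.
Qed.

Lemma hyperplane_form_neq0 V k : generic_lift V -> hyperplane_form V k != 0.
Proof.
move=> Vk; apply/eqP => V0; have := hyperplane_form_skipped k Vk.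
by rewrite V0 mul0mx => /esym/eqP; rewrite (oner_eq0 'M[K]_1).
Qed.

(** A linear form vanishing on the hyperplane is a multiple of its equation; the
    factor is a 1 x 1 matrix. *)
Lemma hyperplane_form_unique V k (psi : 'rV[K]_d.+1) : generic_lift V ->
    (forall i, (i < d.+1)%N -> i != m -> psi *m V (k + i%:Z) = 0) ->
  psi = (psi *m V (k + m%:Z)) *m hyperplane_form V k.
Proof.
move=> Vk psi0; apply/eqP; rewrite -subr_eq0; apply/eqP.
apply: (frame_eq0 (Vk k)) => i lti; rewrite mulmxBl -[X in _ - X]mulmxA.
have [->|ne_im] := eqVneq i m.
  by rewrite hyperplane_form_skipped// mulmx1 subrr.
by rewrite hyperplane_form_kept// mulmx0 subr0 psi0.
Qed.

Lemma mem_dented_hyperplane V v k x : generic_lift V ->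
    (forall j, v j = <[V j]>%VS) ->
  (x \in dented_hyperplane m v k) = (hyperplane_form V k *m x == 0).
Proof.
move=> Vk vV; apply/idP/eqP => [/memv_sumP[y yv ->]|].
  rewrite mulmx_sumr big1// => i ne_im.
  have := yv i ne_im; rewrite vV => /vlineP[t ->].
  by rewrite -scalemxAr hyperplane_form_kept// scaler0.
have [y ->] := frame_span x (Vk k); rewrite mulmx_sumr.
rewrite (bigD1 (inord m))//= big1 ?addr0 => [|i ne_im]; last first.
  rewrite -scalemxAr hyperplane_form_kept ?scaler0//.
  by rewrite -(inj_eq val_inj) /= inordK in ne_im.
rewrite -scalemxAr inordK// hyperplane_form_skipped// => /matrixP/(_ 0 0).
rewrite !mxE mulr1 => ym; apply: memv_suml => i _.
have [eq_im|ne_im] := eqVneq (i : nat) m; first by rewrite eq_im ym scale0r mem0v.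
rewrite memvZ//; apply: (subvP (sumv_sup i ne_im (subvv _))).
by rewrite vV memv_line.
Qed.

Lemma mem_dented V v k x : generic_lift V -> (forall j, v j = <[V j]>%VS) ->
  reflect (forall i, (i < d)%N -> hyperplane_form V (k + i%:Z) *m x = 0)
          (x \in dented m v k).
Proof.
move=> Vk vV; apply: (iffP idP) => [xd i lti|xP].
  apply/eqP; rewrite -(mem_dented_hyperplane _ _ Vk vV).
  by move: xd; rewrite memvE => /subv_bigcapP/(_ (Ordinal lti) isT); rewrite -memvE.
rewrite memvE; apply/subv_bigcapP => i _; rewrite -memvE.
by rewrite (mem_dented_hyperplane _ _ Vk vV) xP.
Qed.

End DentedHyperplanes.

(** * The inverse of the dented map, and refactorization *)

Section Refactorization.
Variables (K : fieldType) (m h : nat).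
Local Notation d := (m + h)%N.
Implicit Types (a b : int -> nat -> K) (c : int -> K).
Implicit Types (V W : int -> 'cV[K]_d.+1).

Definition low p b (X : int -> 'cV[K]_p) j : 'cV[K]_p :=
  \sum_(k < m.+1) b j k *: X (j + k%:Z).

Definition high p b (X : int -> 'cV[K]_p) j : 'cV[K]_p :=
  \sum_(l < h.+1) b j (m.+1 + l)%N *: X (j + (m.+1 + l)%N%:Z).

Lemma sum_low_high p (f : nat -> 'cV[K]_p) :
  \sum_(k < d.+2) f k = \sum_(k < m.+1) f k + \sum_(l < h.+1) f (m.+1 + l)%N.
Proof.
have -> : d.+2 = (m.+1 + h.+1)%N by lia.
exact: big_split_ord.
Qed.

Lemma satisfies_low_high p b (X : int -> 'cV[K]_p) :
  satisfies d b X <-> forall j, high b X j = - low b X j.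
Proof.
split=> bX j; have := bX j.
  rewrite (sum_low_high (fun k => b j k *: X (j + k%:Z))) addrC => /eqP.
  by rewrite addr_eq0 => /eqP.
rewrite (sum_low_high (fun k => b j k *: X (j + k%:Z))) => bXj.
by rewrite -/(low b X j) -/(high b X j) bXj subrr.
Qed.

(** The inverse of the dented map, in lifts.  By the recurrence of W, the vector
    on the right is also - c j *: high b W j, hence the point where the spans of
    W_j, ..., W_(j+m) and W_(j+m+1), ..., W_(j+d+1) meet. *)
Definition inverse_dented b c V W : Prop :=
  forall j, V (j + (m + d)%N%:Z) = c j *: low b W j.

(** The vertex V_(j+m+d) lies on h consecutive hyperplanes before the one that
    skips it, and on m consecutive ones after.  This places it in two complementary
    spans of consecutive vertices of W, and equating the two expansions gives a
    relation between d+2 vertices of W, which must be a multiple of the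
    recurrence. *)
Lemma dented_inverse b V W : generic_lift V -> generic_lift W ->
    polygon_coefs d b -> satisfies d b W ->
    (forall k l, (l < d)%N -> hyperplane_form m V k *m W (k - l%:Z) = 0) ->
  exists c, inverse_dented b c V W.
Proof.
move=> Vj Wj hb bW VW0; pose phi := hyperplane_form m V.
have lemd : (m <= d)%N by rewrite leq_addr.
(* Otherwise phi k would vanish on the whole frame W_(k-d+1), ..., W_(k+1). *)
have phi1 k : phi k *m W (k + 1) != 0.
  apply: contraNneq (hyperplane_form_neq0 lemd k Vj) => W1.
  apply/eqP/(frame_eq0 (Wj (k - d%:Z + 1))) => i; rewrite ltnS leq_eqVlt.
  case/predU1P=> [->|lti]; first by rewrite -[RHS]W1; congr (_ *m W _); lia.
  by rewrite -[RHS](VW0 k (d - 1 - i)%N); [congr (_ *m W _) | ]; lia.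
suff exc j : exists t, V (j + (m + d)%N%:Z) = t *: low b W j.
  by exists (fun j => projT1 (cid (exc j))) => j; case: cid.
have [|i lti|y Vy] := @span_of_annihilated _ d W phi j h
  (V (j + (m + d)%N%:Z)) Wj VW0 phi1.
- by rewrite leq_addl.
- rewrite (_ : j + (m + d)%N%:Z = j + d%:Z - 1 - i%:Z + (m.+1 + i)%N%:Z); last lia.
  by rewrite hyperplane_form_kept//; lia.
have [|i lti|z Vz] := @span_of_annihilated _ d W phi (j + m.+1%:Z) m
  (V (j + (m + d)%N%:Z)) Wj VW0 phi1.
- by [].
- rewrite (_ : j + (m + d)%N%:Z = j + m.+1%:Z + d%:Z - 1 - i%:Z + i%:Z); last lia.
  by rewrite hyperplane_form_kept//; lia.
pose f k := if (k <= m)%N then y k else - z (k - m.+1)%N.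
rewrite (_ : (d.+1 - h)%N = m.+1) in Vy; last lia.
rewrite (_ : (d.+1 - m)%N = h.+1) in Vz; last lia.
have f0 : \sum_(k < d.+2) f k *: W (j + k%:Z) = 0.
  rewrite (sum_low_high (fun k => f k *: W (j + k%:Z))).
  apply/eqP; rewrite addr_eq0 -sumrN; apply/eqP.
  transitivity (V (j + (m + d)%N%:Z)).
    by rewrite Vy; apply: eq_bigr => l _; rewrite /f -ltnS ltn_ord.
  rewrite Vz; apply: eq_bigr => l _.
  rewrite /f leqNgt ltnS leq_addr /= addKn scaleNr opprK.
  congr (_ *: W _); lia.
(* As b_(j,d+1) = -1, the factor c_j is read off at the top vertex. *)
exists (- f d.+1); rewrite Vy /low scaler_sumr; apply: eq_bigr => k _.
rewrite scalerA -(relation_unique Wj hb bW f0) /f -ltnS ?ltn_ord//.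
by have := ltn_ord k; lia.
Qed.

(** The coefficient of W_(j+m+1+p) once each V in the recurrence of V has been
    replaced by a low or a high part of W, chosen so that only d+1 consecutive
    vertices of W occur. *)
Definition refactor_coef a b c j p : K :=
  let J := j + (m + d)%N%:Z in
  \sum_(k < m.+1) \sum_(l < h.+1) ((k + l)%N == p)%:R *
    (a J (m.+1 + l)%N * c (j + (m.+1 + l)%N%:Z) * b (j + (m.+1 + l)%N%:Z) k
     - a J k * c (j + k%:Z) * b (j + k%:Z) (m.+1 + l)%N).

Lemma sum_antidiagonals p (t : nat -> nat -> K) (X : nat -> 'cV[K]_p) :
  \sum_(k < m.+1) \sum_(l < h.+1) t k l *: X (k + l)%N =
  \sum_(q < d.+1)
     (\sum_(k < m.+1) \sum_(l < h.+1) ((k + l)%N == q)%:R * t k l) *: X q.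
Proof.
under [RHS]eq_bigr do rewrite scaler_suml.
rewrite [RHS]exchange_big; apply: eq_bigr => k _.
under [RHS]eq_bigr do rewrite scaler_suml.
rewrite [RHS]exchange_big; apply: eq_bigr => l _.
have ltkl : (k + l < d.+1)%N by have := ltn_ord k; have := ltn_ord l; lia.
rewrite (bigD1 (Ordinal ltkl))//= eqxx mul1r big1 ?addr0// => q ne_q.
by rewrite -(inj_eq val_inj) eq_sym /= in ne_q; rewrite (negPf ne_q) mul0r scale0r.
Qed.

(** In low a V, with shifts 0..m, V is written with the high part of b, with
    shifts m+1..d+1; in high a V it is written with the low part.  Either way
    the total shifts run from m+1 to m+d+1. *)
Lemma low_high_inverse_dented a b c V W j :
    satisfies d b W -> inverse_dented b c V W ->
  \sum_(k < d.+2) a (j + (m + d)%N%:Z) k *: V (j + (m + d)%N%:Z + k%:Z) =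
  \sum_(p < d.+1) refactor_coef a b c j p *: W (j + m.+1%:Z + p%:Z).
Proof.
move=> bW VW; set J := j + _.
rewrite (sum_low_high (fun k => a J k *: V (J + k%:Z))).
have VJ k : V (J + k%:Z) = c (j + k%:Z) *: low b W (j + k%:Z).
  by rewrite -VW /J; congr V; lia.
pose t k l := a J (m.+1 + l)%N * c (j + (m.+1 + l)%N%:Z) * b (j + (m.+1 + l)%N%:Z) k
     - a J k * c (j + k%:Z) * b (j + k%:Z) (m.+1 + l)%N.
rewrite -(sum_antidiagonals t (fun p => W (j + m.+1%:Z + p%:Z))).
have -> : \sum_(k < m.+1) a J k *: V (J + k%:Z) =
  - \sum_(k < m.+1) \sum_(l < h.+1)
     (a J k * c (j + k%:Z) * b (j + k%:Z) (m.+1 + l)%N)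
       *: W (j + m.+1%:Z + (k + l)%N%:Z).
  rewrite -sumrN; apply: eq_bigr => k _; rewrite VJ.
  move/satisfies_low_high: (bW) => /(_ (j + k%:Z)) /eqP.
  rewrite -eqr_oppLR => /eqP <-; rewrite scalerN scalerN; congr (- _).
  rewrite !scaler_sumr; apply: eq_bigr => l _; rewrite !scalerA.
  congr (_ *: W _); lia.
have -> : \sum_(l < h.+1) a J (m.+1 + l)%N *: V (J + (m.+1 + l)%N%:Z) =
  \sum_(k < m.+1) \sum_(l < h.+1)
     (a J (m.+1 + l)%N * c (j + (m.+1 + l)%N%:Z) * b (j + (m.+1 + l)%N%:Z) k)
       *: W (j + m.+1%:Z + (k + l)%N%:Z).
  rewrite exchange_big; apply: eq_bigr => l _; rewrite VJ !scaler_sumr.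
  apply: eq_bigr => k _; rewrite !scalerA; congr (_ *: W _); lia.
rewrite addrC -sumrB; apply: eq_bigr => k _; rewrite -sumrB.
by apply: eq_bigr => l _; rewrite -scalerBl.
Qed.

Lemma refactor_coef_eq0 a b c V W : generic_lift W ->
    satisfies d a V -> satisfies d b W -> inverse_dented b c V W ->
  forall j p, (p < d.+1)%N -> refactor_coef a b c j p = 0.
Proof.
move=> Wj aV bW VW j; apply: (frame_free (Wj (j + m.+1%:Z))).
by rewrite -(low_high_inverse_dented a j bW VW) aV.
Qed.

Definition weight (s : K) k : K :=
  if (k <= m)%N then s ^- k else s ^+ (d.+1 - k).

Definition scale_coefs s a j k : K := weight s k * a j k.

(** A low coefficient of index k and a high one of index m+1+l are multiplied
    together by s^-k s^(h-l), which depends only on k + l = p; exchanging the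
    roles of a and b does not change this. *)
Lemma refactor_coef_scale s a b c j p : s != 0 ->
  refactor_coef (scale_coefs s a) (scale_coefs s b) c j p =
  s ^+ h / s ^+ p * refactor_coef a b c j p.
Proof.
move=> s0; rewrite /refactor_coef mulr_sumr; apply: eq_bigr => k _.
rewrite mulr_sumr; apply: eq_bigr => l _.
have [<-|_] := eqVneq; last by rewrite !mul0r mulr0.
have lek : (k <= m)%N by rewrite -ltnS.
have gtl : (m.+1 + l <= m)%N = false by lia.
rewrite !mul1r /scale_coefs /weight lek gtl.
have -> : s ^+ h = s ^+ l * s ^+ (d.+1 - (m.+1 + l)).
  by rewrite -exprD; congr (_ ^+ _); have := ltn_ord l; lia.
rewrite exprD; field; rewrite !expf_neq0//.
Qed.

Lemma low_mul p q (g : 'M[K]_(q, p)) b (X : int -> 'cV[K]_p) j :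
  low b (fun i => g *m X i) j = g *m low b X j.
Proof.
by rewrite mulmx_sumr; apply: eq_bigr => k _; rewrite scalemxAr.
Qed.

(** Conjugation by s^j turns the scaling into multiplication of the high part
    alone by s^(d+1), the low part being unchanged; compare [high_gauge].  In
    particular a common zero of both parts stays one, up to the gauge. *)
Lemma low_gauge p s b (u : int -> 'cV[K]_p) j : s != 0 ->
  low (scale_coefs s b) u j = s ^ j *: low b (fun i => s ^ (- i) *: u i) j.
Proof.
move=> s0; rewrite /low scaler_sumr; apply: eq_bigr => k _.
have lek : (k <= m)%N by rewrite -ltnS.
rewrite !scalerA /scale_coefs /weight lek; congr (_ *: _).
rewrite exprnN -mulrA [RHS]mulrCA -expfzDr// mulrC; congr (_ * s ^ _); lia.
Qed.

Lemma high_gauge p s b (u : int -> 'cV[K]_p) j : s != 0 ->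
  high (scale_coefs s b) u j =
  s ^ (j + d.+1%:Z) *: high b (fun i => s ^ (- i) *: u i) j.
Proof.
move=> s0; rewrite /high scaler_sumr; apply: eq_bigr => l _.
have gtl : (m.+1 + l <= m)%N = false by lia.
have ltl := ltn_ord l.
rewrite !scalerA /scale_coefs /weight gtl; congr (_ *: _).
rewrite exprnP -mulrA [RHS]mulrCA -expfzDr// mulrC; congr (_ * s ^ _); lia.
Qed.

(** The vertices V' are generic because a linear form phi killing them yields,
    through the gauge, a linear form g killing V. *)
Lemma inverse_dented_scale_generic s a b c V W V' W' : s != 0 ->
    generic_lift V -> generic_lift W -> generic_lift W' ->
    polygon_coefs d b -> satisfies d b W -> inverse_dented b c V W ->
    polygon_coefs d (scale_coefs s a) -> satisfies d (scale_coefs s a) V' ->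
    satisfies d (scale_coefs s b) W' -> inverse_dented (scale_coefs s b) c V' W' ->
  generic_lift V'.
Proof.
move=> s0 Vj Wj W'j hb bW VW ha' aV' bW' VW' j.
apply/negP => /det0P[phi /negP phi0 phiV']; apply: phi0; apply/eqP.
(* Vanishing on one frame propagates along the recurrence of V'. *)
have {}phiV' : forall i, phi *m V' i = 0.
  apply: (satisfies_eq0 (j0 := j) ha' (satisfies_mul phi aV')) => i lti.
  by rewrite mul_frame// phiV'; apply/colP => r; rewrite !mxE.
pose u i := phi *m W' i; pose w i := s ^ (- i) *: u i.
have c0 i : c i != 0.
  apply: contraNneq (frame_neq0 (Vj (i + (m + d)%N%:Z))) => ci.
  by rewrite VW ci scale0r.
have lowu i : low (scale_coefs s b) u i = 0.
  have := phiV' (i + (m + d)%N%:Z).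
  rewrite VW' -scalemxAr => /eqP; rewrite scaler_eq0 (negPf (c0 i)) /= => /eqP.
  by rewrite -low_mul.
have loww i : low b w i = 0.
  have := lowu i; rewrite low_gauge// => /eqP.
  by rewrite scaler_eq0 expfz_eq0 (negPf s0) andbF => /eqP.
have highw i : high b w i = 0.
  have := lowu i; have /satisfies_low_high/(_ i) := satisfies_mul phi bW'.
  rewrite -/u => + lowui; rewrite lowui oppr0 high_gauge// => /eqP.
  by rewrite scaler_eq0 expfz_eq0 (negPf s0) andbF => /eqP.
have bw : satisfies d b w.
  by apply/satisfies_low_high => i; rewrite highw loww oppr0.
have [g wg] := satisfies_unique hb bW bw (Wj 0).
have glow i : g *m low b W i = 0.
  by rewrite -low_mul -(loww i); apply: eq_bigr => q _; rewrite wg.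
have g0 : g = 0.
  apply: (frame_eq0 (Vj 0)) => i _.
  rewrite (_ : 0 + _ = (i%:Z - (m + d)%N%:Z) + (m + d)%N%:Z); last lia.
  by rewrite VW -scalemxAr glow scaler0.
apply: (frame_eq0 (W'j 0)) => i _; apply/eqP.
have /eqP := wg (0 + i%:Z).
by rewrite g0 mul0mx scaler_eq0 expfz_eq0 (negPf s0) andbF.
Qed.

(** The hyperplane through W_(k-d+1), ..., W_k contains V_(k+i) for i < m by the
    expansion in the high part, and for i > m by the expansion in the low part,
    so it is the k-th dented hyperplane of V.  Intersecting d consecutive ones
    leaves the line of W_k. *)
Lemma dented_of_inverse b c V W v k : generic_lift V -> generic_lift W ->
    satisfies d b W -> inverse_dented b c V W ->
    (forall j, v j = <[V j]>%VS) ->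
  dented m v k = <[W k]>%VS.
Proof.
move=> Vj Wj bW VW vV; have lemd : (m <= d)%N by rewrite leq_addr.
(* Skipping the last of d+1 vertices leaves d consecutive ones. *)
pose psi i := hyperplane_form d W (i - d%:Z + 1).
have psi0 i l : (l < d)%N -> psi i *m W (i - l%:Z) = 0.
  move=> ltl; rewrite (_ : i - l%:Z = i - d%:Z + 1 + (d - 1 - l)%N%:Z); last lia.
  by rewrite hyperplane_form_kept//; lia.
have psi1 i : psi i *m W (i + 1) != 0.
  rewrite (_ : i + 1 = i - d%:Z + 1 + d%:Z); last lia.
  by rewrite hyperplane_form_skipped// (oner_neq0 'M[K]_1).
have psiV i l : (l < d.+1)%N -> l != m -> psi i *m V (i + l%:Z) = 0.
  move=> ltl ne_lm; pose j := i + l%:Z - (m + d)%N%:Z.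
  rewrite (_ : i + _ = j + (m + d)%N%:Z); last by rewrite /j; lia.
  rewrite VW -scalemxAr; have [ltlm|gtlm] : (l < m \/ m < l)%N by lia.
    move/satisfies_low_high: (bW) => /(_ j) /eqP; rewrite -eqr_oppLR => /eqP <-.
    rewrite mulmxN mulmx_sumr big1 ?oppr0 ?scaler0// => q _; have := ltn_ord q => ltq.
    rewrite -scalemxAr (_ : j + _ = i - (d - 1 - l - q)%N%:Z); last by rewrite /j; lia.
    by rewrite psi0 ?scaler0//; lia.
  rewrite mulmx_sumr big1 ?scaler0// => q _; have := ltn_ord q => ltq.
  rewrite -scalemxAr (_ : j + _ = i - (m + d - l - q)%N%:Z); last by rewrite /j; lia.
  by rewrite psi0 ?scaler0//; lia.
have formE i x : hyperplane_form m V i *m x = 0 <-> psi i *m x = 0.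
  have := hyperplane_form_unique lemd Vj (psiV i).
  rewrite [psi i *m _]mx11_scalar mul_scalar_mx; set t := _ 0 0 => def_psi.
  rewrite def_psi -scalemxAl; split=> [->|/eqP]; first by rewrite scaler0.
  rewrite scaler_eq0 => /predU1P[t0|/eqP//].
  by have := psi1 i; rewrite def_psi t0 scale0r mul0mx eqxx.
apply/vspaceP => x; apply/(mem_dented lemd _ _ Vj vV)/vlineP => [xP|[t ->] i lti].
  have [i lti|y ->] := @span_of_annihilated _ d W psi k d x Wj psi0 psi1 (leqnn d).
    rewrite (_ : k + _ - _ - _ = k + (d - 1 - i)%N%:Z); last lia.
    by apply/formE/xP; lia.
  by rewrite subSnn big_ord1 addr0; exists (y 0%N).
rewrite -scalemxAr (_ : hyperplane_form m V _ *m _ = 0) ?scaler0//.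
by apply/formE; rewrite -[k in W k](addrK i%:Z) psi0.
Qed.

End Refactorization.

(** * Coordinates as periodic recurrences *)

Section Coordinates.
Variables (K : fieldType) (n d : nat).
Hypothesis n_gt0 : (0 < n)%N.
Implicit Types (A B : 'M[K]_(n, d)) (V W : int -> 'cV[K]_d.+1).

(** The entries extended by 0, so that indices can be plain numbers. *)
Definition entry A i k : K :=
  if (insub i : option 'I_n) is Some i' then
    if (insub k : option 'I_d) is Some k' then A i' k' else 0
  else 0.

Definition coefs A (j : int) k : K :=
  if k == 0%N then (-1) ^+ d
  else if k == d.+1 then -1 else entry A `|(j %% n)%Z|%N k.-1.

Lemma coefs_polygon A : polygon_coefs d (coefs A).
Proof. by move=> j; rewrite /coefs /= eqxx. Qed.

Lemma coefs_periodic A j k : coefs A (j + n%:Z) k = coefs A j k.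
Proof. by rewrite /coefs modzDr. Qed.

Lemma coefs_entry A (j : 'I_n) (q : int) (k : 'I_d) :
  coefs A (j%:Z + q * n%:Z) k.+1 = A j k.
Proof.
have -> : coefs A (j%:Z + q * n%:Z) k.+1 = entry A j k.
  rewrite /coefs /= eqSS ltn_eqF// addrC modzMDl modz_small//=.
  by have := ltn_ord j; lia.
by rewrite /entry !valK.
Qed.

(** Division by n writes every integer as j + q n with j : 'I_n. *)
Lemma coefs_recurrence A V :
  (forall (j : 'I_n) (q : int), let j' := (j : nat)%:Z + q * n%:Z in
     V (j' + d.+1%:Z) =
       \sum_(k < d) A j k *: V (j' + k.+1%:Z) + (-1) ^+ d *: V j') <->
  satisfies d (coefs A) V.
Proof.
have step (j : 'I_n) (q : int) : let j' := (j : nat)%:Z + q * n%:Z in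
    \sum_(k < d.+2) coefs A j' k *: V (j' + k%:Z) =
    \sum_(k < d) A j k *: V (j' + k.+1%:Z) + (-1) ^+ d *: V j'
      - V (j' + d.+1%:Z).
  move=> j'; rewrite big_ord_recl big_ord_recr /= addr0.
  rewrite {1}/coefs eqxx (coefs_polygon A _).2 scaleN1r addrA; congr (_ - _).
  rewrite addrC; congr (_ + _); apply: eq_bigr => k _.
  by rewrite coefs_entry.
split=> [AV j|AV j q]; last first.
  by apply/esym/eqP; rewrite -subr_eq0 -step AV.
have ltj : (`|(j %% n)%Z| < n)%N.
  by have := @ltz_pmod j n n_gt0; have := @modz_ge0 j n; lia.
have -> : j = (Ordinal ltj : nat)%:Z + (j %/ n)%Z * n%:Z.
  rewrite [LHS](divz_eq j n) addrC /= gez0_abs// modz_ge0//; lia.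
by rewrite step AV subrr.
Qed.

Lemma coefs_inj A B :
  (forall j k, (k <= d.+1)%N -> coefs A j k = coefs B j k) -> A = B.
Proof.
move=> AB; apply/matrixP => j k; rewrite -(coefs_entry A j 0) AB ?coefs_entry//.
by have := ltn_ord k; lia.
Qed.

End Coordinates.

Lemma coefs_scaling (K : fieldType) (n m h : nat) s (A : 'M[K]_(n, m + h)) j k :
  coefs (scaling m s A) j k = scale_coefs m h s (coefs A) j k.
Proof.
rewrite /scale_coefs /weight /coefs.
case: k => [|k] /=; first by rewrite expr0 invr1 mul1r.
have [[->]|_] := eqVneq k.+1 (m + h).+1.
  by rewrite ifF ?subnn ?mul1r//; lia.
rewrite /entry; case: insub => [i|]; last by rewrite mulr0.
by case: insubP => [k' _ <-|_]; rewrite ?mulr0// mxE.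
Qed.

(** By Bezout, 1 is a period. *)
Lemma periodic_coprime (T : Type) (f : int -> T) p q : coprime p q ->
    (forall j, f (j + p%:Z) = f j) -> (forall j, f (j + q%:Z) = f j) ->
  forall j, f j = f 0.
Proof.
move=> pq fp fq j.
have mul r : (forall i, f (i + r%:Z) = f i) -> forall u i, f (i + u * r%:Z) = f i.
  move=> fr u i; elim/int_rect: u => [|u IH|u IH]; first by rewrite mul0r addr0.
    by rewrite -IH -[RHS]fr; congr f; lia.
  by rewrite -IH -[LHS]fr; congr f; lia.
have /coprimezP[[u w] /= uw] : coprimez p%:Z q%:Z by [].
rewrite -(mul p fp (- j * u)) -(mul q fq (- j * w)); congr f.
by rewrite -addrA -!mulrA -mulrDr uw mulr1 subrr.
Qed.

(** * The graph of the dented map *)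

Section PolygonLifts.
Variables (K : fieldType) (n d m : nat).
Hypothesis n_gt0 : (0 < n)%N.
Implicit Types (A B : 'M[K]_(n, d)) (V W : int -> 'cV[K]_d.+1).
Implicit Types (M : 'M[K]_d.+1) (v : int -> {vspace 'cV[K]_d.+1}).

Definition lift_of M V v A : Prop :=
  [/\ forall j, v j = <[V j]>%VS, forall j, \det (frame V j) = 1,
      forall j, V (j + n%:Z) = M *m V j & satisfies d (coefs A) V].

Lemma lift_of_generic M V v A : lift_of M V v A -> generic_lift V.
Proof. by case=> _ detV _ _ j; rewrite detV oner_neq0. Qed.

Lemma ngon_coords_lift M v A : ngon_coords M v A <-> exists V, lift_of M V v A.
Proof.
by split=> -[V [vV dV MV AV]]; exists V; split=> //; apply/coefs_recurrence.
Qed.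

Lemma lift_twisted M V v A : \det M = 1 -> lift_of M V v A -> twisted_ngon n M v.
Proof.
move=> dM liftV; have Vj := lift_of_generic liftV.
case: liftV => vV dV MV AV; split=> //.
- by move=> k; rewrite /proj_point vV dim_vline frame_neq0.
- by move=> k; rewrite !vV limg_line lfunE MV.
- exact: generic_lift_polygon Vj vV.
Qed.

Lemma lift_mul M V v A g : \det g = 1 -> lift_of M V v A ->
  lift_of (g *m M *m invmx g) (fun j => g *m V j) (fun j => <[g *m V j]>%VS) A.
Proof.
move=> dg [_ dV MV AV]; have ug : g \in unitmx by rewrite unitmxE dg unitr1.
split=> // [j|j|]; first by rewrite frame_mulmx det_mulmx dg dV mulr1.
  by rewrite MV -!mulmxA mulKmx.
exact: satisfies_mul.
Qed.

(** The ratio l of the two lifts is n-periodic because the monodromy is the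
    same, and (d+1)-periodic because d+1 consecutive ratios multiply to 1.  So it is
    constant, and both lifts satisfy both recurrences. *)
Lemma lift_unique M V W v A B : coprime n d.+1 ->
  lift_of M V v A -> lift_of M W v B -> A = B.
Proof.
move=> cop liftV liftW; have hA := coefs_polygon A; have hB := coefs_polygon B.
have Wj := lift_of_generic liftW.
case: liftV liftW => [vV dV MV AV] [vW dW MW BW].
have exl j : exists t, V j = t *: W j by apply/vlineP; rewrite -vW vV memv_line.
pose l j := projT1 (cid (exl j)).
have Vl j : V j = l j *: W j by rewrite /l; case: cid.
have prodl j : \prod_(i < d.+1) l (j + i%:Z) = 1.
  rewrite -[RHS](dV j) -[LHS]mul1r -[X in X * _](dW j).
  have -> : frame V j = frame W j *m diag_mx (\row_i l (j + (i : nat)%:Z)).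
    by apply/matrixP => r c; rewrite mul_mx_diag !mxE Vl mxE mulrC.
  by rewrite det_mulmx det_diag; congr (_ * _); apply: eq_bigr => i _; rewrite mxE.
have l_neq0 j : l j != 0.
  apply: contraNneq (oner_neq0 K) => lj.
  by rewrite -(prodl j) big_ord_recl addr0 lj mul0r.
have ld j : l (j + d.+1%:Z) = l j.
  apply: (mulIf (x := \prod_(i < d) l (j + 1 + i%:Z))).
    by have := prodl (j + 1); rewrite big_ord_recr /= => /eqP;
       apply: contraTneq => ->; rewrite mul0r eq_sym oner_eq0.
  transitivity (1 : K).
    rewrite -[RHS](prodl (j + 1)) big_ord_recr /= mulrC; congr (_ * l _); lia.
  rewrite -[LHS](prodl j) big_ord_recl addr0; congr (_ * _).
  by apply: eq_bigr => i _; congr l; rewrite lift0; lia.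
have ln j : l (j + n%:Z) = l j.
  apply/eqP; rewrite -subr_eq0; have /eqP := MV j.
  rewrite !Vl -scalemxAr -MW -subr_eq0 -scalerBl scaler_eq0.
  by rewrite (negPf (frame_neq0 (Wj _))) orbF.
have l_const j : l j = l 0 by apply: periodic_coprime cop ln ld j.
have AW : satisfies d (coefs A) W.
  move=> j; apply: (scalerI (l_neq0 0)); rewrite scaler0 -[RHS](AV j) scaler_sumr.
  by apply: eq_bigr => k _; rewrite Vl l_const !scalerA mulrC.
apply: (coefs_inj n_gt0) => j k lek.
by rewrite (relation_unique Wj hB BW (AW j))// (hA j).2 opprK mul1r.
Qed.

(** Two polygons with coordinates A differ by some g in SL_(d+1), which commutes
    with the dented map and carries the lift of one image to a lift of the
    other. *)
Lemma dented_graph_functional A B B' : (m <= d)%N -> coprime n d.+1 ->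
  dented_graph m A B -> dented_graph m A B' -> B = B'.
Proof.
move=> lemd cop [M [v [_ /ngon_coords_lift[V liftV] _ /ngon_coords_lift[W liftW]]]].
move=> [M' [v' [_ /ngon_coords_lift[V' liftV'] _ /ngon_coords_lift[W' liftW']]]].
have Vj := lift_of_generic liftV; have Wj := lift_of_generic liftW.
have V'j := lift_of_generic liftV'; have W'j := lift_of_generic liftW'.
have [vV dV MV AV] := liftV; have [vV' dV' MV' AV'] := liftV'.
have [g V'g] := satisfies_unique (coefs_polygon A) AV AV' (Vj 0).
have frV' j : frame V' j = g *m frame V j.
  by rewrite -frame_mulmx; apply/matrixP => r c; rewrite !mxE V'g !mxE.
have dg : \det g = 1 by rewrite -(dV' 0) frV' det_mulmx dV mulr1.
have ug : g \in unitmx by rewrite unitmxE dg unitr1.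
have def_M' : M' = g *m M *m invmx g.
  rewrite -[LHS](mulmxK ug); congr (_ *m _).
  apply/eqP; rewrite -subr_eq0; apply/eqP/(frame_eq0 (Vj 0)) => i _.
  by rewrite mulmxBl -!mulmxA -V'g -MV -MV' V'g subrr.
have formg k x : hyperplane_form m V' k *m (g *m x) = hyperplane_form m V k *m x.
  have uV : frame V k \in unitmx by rewrite unitmxE dV unitr1.
  rewrite mulmxA; congr (_ *m _); rewrite /hyperplane_form -row_mul frV'.
  congr (row _ _); apply: (can_inj (mulKmx uV)); apply: (can_inj (mulmxK uV)).
  rewrite mulmxV// mul1mx -mulmxA; apply: (can_inj (mulKmx ug)).
  by rewrite !mulmxA mulmxV ?mul1mx// unitmx_mul ug.
apply: (lift_unique cop _ liftW'); rewrite def_M'.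
have -> : dented m v' = fun j => <[g *m W j]>%VS.
  apply/funext => j; have [wW _ _ _] := liftW; have [wW' _ _ _] := liftW'.
  have gWj : g *m W j != 0.
    apply: contraNneq (frame_neq0 (Wj j)) => gW.
    by rewrite -(mulKmx ug (W j)) gW mulmx0.
  apply/esym/eqP; rewrite eqEdim -memvE wW' !dim_vline gWj (frame_neq0 (W'j j)) andbT.
  rewrite -wW'; apply/(mem_dented lemd _ _ V'j vV') => i lti; rewrite formg.
  by move: i lti; apply/(mem_dented lemd _ _ Vj vV); rewrite wW memv_line.
exact: lift_mul dg liftW.
Qed.

End PolygonLifts.

(** The scaled polygons are constructed from the scaled coefficients, with the
    same scalars c up to the constant t. *)
Lemma dented_graph_scaling (K : fieldType) (n m h : nat) s
    (A B : 'M[K]_(n, m + h)) :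
    (0 < n)%N -> s != 0 -> (forall x : K, exists y, y ^+ (m + h).+1 = x) ->
  dented_graph m A B -> dented_graph m (scaling m s A) (scaling m s B).
Proof.
move=> n_gt0 s0 roots; have lemd : (m <= m + h)%N by rewrite leq_addr.
have to_lift := ngon_coords_lift n_gt0.
move=> [M [v [_ /to_lift[V liftV] _ /to_lift[W liftW]]]].
have Vj := lift_of_generic liftV; have Wj := lift_of_generic liftW.
have [vV dV MV AV] := liftV; have [wW dW MW BW] := liftW.
have hB := coefs_polygon B.
have hA' := coefs_polygon (scaling m s A); have hB' := coefs_polygon (scaling m s B).
have [c VW] : exists c, inverse_dented (coefs B) c V W.
  apply: (dented_inverse Vj Wj hB BW) => k l ltl.
  have : W (k - l%:Z) \in dented m v (k - l%:Z) by rewrite wW memv_line.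
  by move/(mem_dented lemd _ _ Vj vV)/(_ l ltl); rewrite subrK.
have cn j : c (j + n%:Z) = c j.
  have lown : low m (coefs B) W (j + n%:Z) = M *m low m (coefs B) W j.
    rewrite mulmx_sumr; apply: eq_bigr => k _.
    by rewrite coefs_periodic addrAC MW scalemxAr.
  apply/eqP; rewrite -subr_eq0; have /eqP := MV (j + (m + (m + h))%N%:Z).
  rewrite addrAC !VW -scalemxAr -lown -subr_eq0 -scalerBl scaler_eq0.
  case/orP=> // /eqP low0.
  have := frame_neq0 (Vj (j + n%:Z + (m + (m + h))%N%:Z)).
  by rewrite VW low0 scaler0 eqxx.
have eA : coefs (scaling m s A) = scale_coefs m h s (coefs A).
  by apply/funext => j; apply/funext => k; rewrite coefs_scaling.
have eB : coefs (scaling m s B) = scale_coefs m h s (coefs B).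
  by apply/funext => j; apply/funext => k; rewrite coefs_scaling.
have [W' BW' dW'] := satisfies_exists hB'.
have W'j : generic_lift W' by move=> j; rewrite dW' oner_neq0.
pose V0 j := c (j - (m + (m + h))%N%:Z) *:
  low m (coefs (scaling m s B)) W' (j - (m + (m + h))%N%:Z).
have VW0 : inverse_dented (coefs (scaling m s B)) c V0 W'.
  by move=> j; rewrite /V0 addrK.
have AV0 : satisfies (m + h) (coefs (scaling m s A)) V0.
  move=> j; rewrite -[j](subrK (m + (m + h))%N%:Z).
  rewrite (low_high_inverse_dented _ _ BW' VW0) big1// => p _.
  rewrite eA eB refactor_coef_scale//.
  by rewrite (refactor_coef_eq0 Wj AV BW VW) ?mulr0 ?scale0r.
have V0j : generic_lift V0.
  rewrite eA eB in AV0 VW0 BW' hA' hB'.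
  exact: (inverse_dented_scale_generic s0 Vj Wj W'j hB BW VW hA' AV0 BW' VW0).
(* One root suffices: the determinants of the frames of V0 are all equal. *)
have [t td] := roots (\det (frame V0 0))^-1.
pose V' j := t *: V0 j.
have frV' j : frame V' j = t *: frame V0 j by apply/matrixP => r k; rewrite !mxE.
have dV' j : \det (frame V' j) = 1.
  by rewrite frV' detZ (det_frame_const hA' AV0) td mulVf.
have V'j : generic_lift V' by move=> j; rewrite dV' oner_neq0.
have VW' : inverse_dented (coefs (scaling m s B)) (fun j => t * c j) V' W'.
  by move=> j; rewrite /V' VW0 scalerA.
have AV' : satisfies (m + h) (coefs (scaling m s A)) V'.
  move=> j; rewrite -[RHS](scaler0 _ t) -[in RHS](AV0 j) scaler_sumr.
  by apply: eq_bigr => k _; rewrite /V' !scalerA (mulrC t).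
have BWn : satisfies (m + h) (coefs (scaling m s B)) (fun j => W' (j + n%:Z)).
  by apply: satisfies_shift BW' => j k; rewrite coefs_periodic.
have [M' MW'] := satisfies_unique hB' BW' BWn (W'j 0).
have dM' : \det M' = 1.
  rewrite -(dW' (0 + n%:Z)) -[LHS]mulr1 -(dW' 0) -det_mulmx -frame_mulmx.
  by congr (\det _); apply/matrixP => r k; rewrite [LHS]mxE [RHS]mxE -MW' addrAC.
have MV' j : V' (j + n%:Z) = M' *m V' j.
  rewrite -[j](subrK (m + (m + h))%N%:Z) addrAC !VW' cn -scalemxAr; congr (_ *: _).
  rewrite mulmx_sumr; apply: eq_bigr => k _.
  by rewrite coefs_periodic addrAC MW' scalemxAr.
pose v' j := <[V' j]>%VS.
have wW' : dented m v' = fun j => <[W' j]>%VS.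
  by apply/funext => j; apply: dented_of_inverse V'j W'j BW' VW' _.
have liftV' : lift_of M' V' v' (scaling m s A) by [].
have liftW' : lift_of M' W' (dented m v') (scaling m s B) by rewrite wW'.
exists M', v'; split.
- exact: lift_twisted dM' liftV'.
- by apply/to_lift; exists V'.
- exact: lift_twisted dM' liftW'.
- by apply/to_lift; exists W'.
Qed.

Lemma scaling_scaling (K : fieldType) (n d m : nat) (s t : K) (A : 'M[K]_(n, d)) :
  scaling m s (scaling m t A) = scaling m (s * t) A.
Proof.
by apply/matrixP => j k; rewrite !mxE mulrA; case: ifP => _; rewrite exprMn ?invfM.
Qed.

Lemma scaling1 (K : fieldType) (n d m : nat) (A : 'M[K]_(n, d)) : scaling m 1 A = A.
Proof.
by apply/matrixP => j k; rewrite !mxE !expr1n invr1 if_same mul1r.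
Qed.

Lemma dented_coords_eq (K : fieldType) (n d m : nat) (A B : 'M[K]_(n, d)) :
    (forall C C', dented_graph m A C -> dented_graph m A C' -> C = C') ->
  dented_graph m A B -> dented_coords m A = Some B.
Proof.
move=> uniqA AB; rewrite /dented_coords; case: pselect => [AC|[]]; last by exists B.
by case: cid => C /= ?; congr Some; apply: uniqA.
Qed.

Theorem theorem2p4 (R : realType) (d m n : nat) (hd : (2 <= d)%N)
    (hm : (1 <= m <= d - 1)%N) (hn : coprime n d.+1)
    (s : R[i]) (hs : s != 0) (A : 'M[R[i]]_(n, d)) :
  dented_coords m (scaling m s A) = omap (scaling m s) (dented_coords m A).
Proof.
have lemd : (m <= d)%N by lia.
have n_gt0 : (0 < n)%N.
  by case: n hn {A} => // /eqP; rewrite gcd0n; lia.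
have functional (C B B' : 'M[R[i]]_(n, d)) :
    dented_graph m C B -> dented_graph m C B' -> B = B'.
  exact: (dented_graph_functional n_gt0 lemd hn).
have roots (x : R[i]) : exists y, y ^+ d.+1 = x.
  by exists (d.+1.-root x); rewrite rootCK.
have scale t (C B : 'M[R[i]]_(n, d)) : t != 0 -> dented_graph m C B ->
    dented_graph m (scaling m t C) (scaling m t B).
  move=> t0; have [h def_d] : exists h, d = (m + h)%N by exists (d - m)%N; lia.
  by move: C B roots; rewrite def_d => C B; apply: dented_graph_scaling.
rewrite [in RHS]/dented_coords; case: pselect => [AB|nAB] /=.
  case: cid => B /= AB'.
  exact: dented_coords_eq (@functional _) (scale _ _ _ hs AB').
rewrite /dented_coords; case: pselect => // -[B' AB']; case: nAB.
exists (scaling m s^-1 B').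
rewrite -[A](scaling1 m) -(mulVf hs) -scaling_scaling.
by apply: scale; rewrite ?invr_eq0.
Qed.
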